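(* Let $Q^{(1)},\dots,Q^{(n)}\in\mathbb{T}_\pm^{m\times m}$ be symmetric tropical Metzler matrices satisfying: (a) for all $k\in[n]$, the matrix $Q^{(k)}$ has at least one coefficient in $\mathbb{T}_-$; (b) for all $i\in[m]$ there exists $k\in[n]$ such that $Q^{(k)}_{ii}\in\mathbb{T}_+$. Let $\Gamma$ be the associated stochastic mean payoff game and let $\chi\in\mathbb{R}^n$ be its value. Then, for every $\lambda\in\mathbb{R}$, the set $\mathcal{S}_\lambda$ is nontrivial if and only if $\lambda\le 2\max_{k\in[n]}\chi_k$. In particular, the tropical spectrahedron $\mathcal{S}=\mathcal{S}_0$ is nontrivial if and only if the stochastic game $\Gamma$ has at least one winning initial state.
   Context: Tropical notation. $[m]=\{1,\dots,m\}$. $\mathbb{T}=\mathbb{R}\cup\{-\infty\}$ with the usual order. $\mathbb{T}_\pm$ is the disjoint union of $\mathbb{T}_+=\mathbb{R}$ (positive elements), $\mathbb{T}_-=\{\ominus a:a\in\mathbb{R}\}$ (a formal second copy of $\mathbb{R}$, negative elements) and $\{-\infty\}$; modulus $|a|=|\ominus a|=a$, $|-\infty|=-\infty$. A matrix over $\mathbb{T}_\pm$ is tropical Metzler if its off-diagonal entries lie in $\mathbb{T}_-\cup\{-\infty\}$. For $x\in\mathbb{T}^n$ put $Q_{ij}^{\pm}(x)=\max_{k:\,Q_{ij}^{(k)}\in\mathbb{T}_\pm\text{ of that sign}}(|Q_{ij}^{(k)}|+x_k)$ (i.e. $Q^+_{ij}$ uses the $k$ with $Q_{ij}^{(k)}\in\mathbb{T}_+$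 and $Q^-_{ij}$ those with $Q_{ij}^{(k)}\in\mathbb{T}_-$; $\max\emptyset=-\infty$). For $\lambda\in\mathbb{R}$, $\mathcal{S}_\lambda$ is the set of $x\in\mathbb{T}^n$ with $Q_{ii}^+(x)\ge\lambda+Q_{ii}^-(x)$ for all $i\in[m]$ and $Q_{ii}^+(x)+Q_{jj}^+(x)\ge 2(\lambda+Q_{ij}^-(x))$ for all $i<j$ in $[m]$. A subset of $\mathbb{T}^n$ is nontrivial if it contains a point different from $(-\infty,\dots,-\infty)$. Stochastic mean payoff games. Player Min owns states $[n]$, Player Max owns states $[m]$. For each $k\in[n]$ there is a nonempty set $A^{(k)}$ of actions, each a subset of $[m]$ of cardinality $1$ or $2$; for each $i\in[m]$ a nonempty set $B^{(i)}$ of actions, each a singleton of $[n]$; real payments $r^a_k$ ($a\in A^{(k)}$) and $r^b_i$ ($b\in B^{(i)}$). From $k$, Min picks $a\in A^{(k)}$, pays $r_k^a$ to Max, and the pawn moves to an element of $a$ chosen uniformly at random; from $i$, Max picks $b=\{l\}\in B^{(i)}$, receives $r_i^b$, and the pawn moves to $l$. Policies are maps $\sigma:k\mapsto\sigma(k)\in A^{(k)}$ and $\tau:i\mapsto\tau(i)\in B^{(i)}$. The payoff from initial state $k_1=k\in[n]$ is $g_k(\sigma,\tau)=\lim_{N\to\infty}\mathbb{E}_{\sigma,\tau}\bigl(\frac{1}{2N}\sum_{p=1}^N(r^{\sigma(k_p)}_{k_p}+r^{\tau(i_p)}_{i_p})\bigr)$, over trajectories $k_1,i_1,k_2,i_2,\dots$.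 It is known (Liggett–Lippman) that there exist policies $(\overline\sigma,\overline\tau)$ and a unique vector $\chi\in\mathbb{R}^n$, the value, such that $g_k(\overline\sigma,\tau)\le\chi_k\le g_k(\sigma,\overline\tau)$ for all $k,\sigma,\tau$. A state $k\in[n]$ is winning (for Max) if $\chi_k\ge0$. The game $\Gamma$ associated with $Q^{(1)},\dots,Q^{(n)}$: $A^{(k)}$ consists of the actions $\{i\}$ with payment $-|Q_{ii}^{(k)}|$ for all $i$ with $Q_{ii}^{(k)}\in\mathbb{T}_-$, and the actions $\{i,j\}$ with payment $-|Q_{ij}^{(k)}|$ for all $i<j$ with $Q_{ij}^{(k)}\in\mathbb{T}_-$; $B^{(i)}$ consists of the actions $\{k\}$ with payment $Q_{ii}^{(k)}$ for all $k$ with $Q_{ii}^{(k)}\in\mathbb{T}_+$. *)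

(* Defs.v *)
(* MathComp-Analysis. *)
From mathcomp Require Import all_boot all_order all_algebra.
From mathcomp Require Import all_classical all_reals all_analysis.

Set Implicit Arguments.
Unset Strict Implicit.
Unset Printing Implicit Defensive.

Import Order.TTheory GRing.Theory Num.Theory.
Import numFieldNormedType.Exports.

Local Open Scope classical_set_scope.
Local Open Scope ring_scope.

(* [TPos a] is the positive element a, [TNeg a] is the formal copy (-)a, and
   [TNinf] is -oo. *)
Inductive strop (R : Type) := TPos of R | TNeg of R | TNinf.
Arguments TNinf {R}.

Definition tpos (R : Type) (t : strop R) : bool :=
  if t is TPos _ then true else false.

Definition tneg (R : Type) (t : strop R) : bool :=
  if t is TNeg _ then true else false.

Definition tmod (R : Type) (t : strop R) : \bar R :=
  match t with
  | TPos a => a%:E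
  | TNeg a => a%:E
  | TNinf => -oo%E
  end.

Definition tropical_Metzler (R : Type) (m : nat) (A : 'M[strop R]_m) : Prop :=
  forall i j : 'I_m, i != j -> tneg (A i j) \/ A i j = TNinf.

Definition tsymmetric (R : Type) (m : nat) (A : 'M[strop R]_m) : Prop :=
  A^T%R = A.

Section Spectrahedron.
Variables (R : realType) (n m : nat) (Q : 'I_n -> 'M[strop R]_m).
Local Open Scope ereal_scope.

Definition Qplus (i j : 'I_m) (x : 'I_n -> \bar R) : \bar R :=
  \big[maxe/-oo]_(k < n | tpos (Q k i j)) (tmod (Q k i j) + x k).

Definition Qminus (i j : 'I_m) (x : 'I_n -> \bar R) : \bar R :=
  \big[maxe/-oo]_(k < n | tneg (Q k i j)) (tmod (Q k i j) + x k).

(* A point of (R U {-oo})^n is a vector of extended reals without any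
   coordinate equal to +oo. *)
Definition tspec (lambda : R) : set ('I_n -> \bar R) :=
  [set x | [/\ forall k, x k < +oo,
     forall i : 'I_m, lambda%:E + Qminus i i x <= Qplus i i x &
     forall i j : 'I_m, (i < j)%N ->
       2%:E * (lambda%:E + Qminus i j x) <= Qplus i i x + Qplus j j x]].

End Spectrahedron.

Definition nontrivial (R : realType) (n : nat) (S : set ('I_n -> \bar R)) :
  Prop := exists2 x, S x & x <> (fun=> -oo%E).

(* Player Min owns the states 'I_n, player Max owns the states 'I_m.
   An action {l} of Max is represented by its unique element l.  The payments
   are total functions, of which only the values at available actions matter. *)
Record smpg (R : realType) (n m : nat) := Smpg {
  minA : 'I_n -> {set {set 'I_m}};
  maxB : 'I_m -> {set 'I_n};
  min_pay : 'I_n -> {set 'I_m} -> R;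
  max_pay : 'I_m -> 'I_n -> R;
  minA_neq0 : forall k, minA k != finset.set0;
  minA_card : forall k a, a \in minA k -> (#|a| == 1%N) || (#|a| == 2%N);
  maxB_neq0 : forall i, maxB i != finset.set0
}.

Section Game.
Variables (R : realType) (n m : nat) (G : smpg R n m).

Definition min_policy (sigma : 'I_n -> {set 'I_m}) : Prop :=
  forall k, sigma k \in minA G k.

Definition max_policy (tau : 'I_m -> 'I_n) : Prop :=
  forall i, tau i \in maxB G i.

Section Payoff.
Variables (sigma : 'I_n -> {set 'I_m}) (tau : 'I_m -> 'I_n).

(* Since the moves of Max are deterministic, the trajectory k_1, i_1, k_2, ...
   is determined by k = k_1 and s = [:: i_1; i_2; ...], via
   k_(p+1) = tau i_p. *)
Fixpoint traj_prob (k : 'I_n) (s : seq 'I_m) : R :=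
  if s is i :: s' then
    (if i \in sigma k then #|sigma k|%:R^-1 else 0) * traj_prob (tau i) s'
  else 1.

Fixpoint traj_payment (k : 'I_n) (s : seq 'I_m) : R :=
  if s is i :: s' then
    (min_pay G k (sigma k) + max_pay G i (tau i)) + traj_payment (tau i) s'
  else 0.

Definition mean_payment (k : 'I_n) (N : nat) : R :=
  \sum_(s : N.-tuple 'I_m)
    traj_prob k s * ((2 * N%:R)^-1 * traj_payment k s).

Definition payoff (k : 'I_n) : R := lim (mean_payment k N @[N --> \oo]).

End Payoff.

Definition is_value (chi : 'I_n -> R) : Prop :=
  exists sigma0 tau0, [/\ min_policy sigma0, max_policy tau0 &
    forall k sigma tau, min_policy sigma -> max_policy tau ->
      payoff sigma0 tau k <= chi k /\ chi k <= payoff sigma tau0 k].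

End Game.

Definition winning (R : realType) (n : nat) (chi : 'I_n -> R) (k : 'I_n) :
  Prop := 0 <= chi k.

Section AssociatedGame.
Variables (R : realType) (n m : nat) (Q : 'I_n -> 'M[strop R]_m).

(* [set i; i] is the singleton action {i}. *)
Definition assoc_minA (k : 'I_n) : {set {set 'I_m}} :=
  finset (fun a : {set 'I_m} =>
    [exists i : 'I_m, exists j : 'I_m,
      [&& (i <= j)%N, tneg (Q k i j) & a == [set i; j]%SET]]).

(* The pair i <= j such that a = {i, j} is unique. *)
Definition assoc_min_pay (k : 'I_n) (a : {set 'I_m}) : R :=
  if [pick ij : 'I_m * 'I_m | (ij.1 <= ij.2)%N && (a == [set ij.1; ij.2]%SET)]
    is Some ij then - fine (tmod (Q k ij.1 ij.2)) else 0.

Definition assoc_maxB (i : 'I_m) : {set 'I_n} :=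
  finset (fun k : 'I_n => tpos (Q k i i)).

Definition assoc_max_pay (i : 'I_m) (k : 'I_n) : R := fine (tmod (Q k i i)).

Hypothesis Qsym : forall k, tsymmetric (Q k).
Hypothesis Qneg : forall k, exists i j, tneg (Q k i j).
Hypothesis Qpos : forall i, exists k, tpos (Q k i i).

Lemma assoc_minA_neq0 k : assoc_minA k != finset.set0.
Proof.
have [i [j nij]] := Qneg k.
apply/set0Pn; exists [set i; j]%SET; rewrite inE.
case/orP: (leq_total i j) => lij.
  by apply/existsP; exists i; apply/existsP; exists j; rewrite lij nij eqxx.
apply/existsP; exists j; apply/existsP; exists i.
by rewrite lij -(Qsym k) mxE nij finset.setUC eqxx.
Qed.

Lemma assoc_minA_card k a :
  a \in assoc_minA k -> (#|a| == 1%N) || (#|a| == 2%N).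
Proof.
rewrite inE => /existsP[i /existsP[j /and3P[_ _ /eqP->]]].
by rewrite cards2; case: (i != j).
Qed.

Lemma assoc_maxB_neq0 i : assoc_maxB i != finset.set0.
Proof. by have [k pk] := Qpos i; apply/set0Pn; exists k; rewrite inE. Qed.

Definition assoc_game : smpg R n m :=
  Smpg assoc_min_pay assoc_max_pay assoc_minA_neq0 assoc_minA_card assoc_maxB_neq0.

End AssociatedGame.

(* Main.v *)
(* A point x of S_lambda is a vector with lambda + x <= F x, where F is the
   Shapley operator of the game.  If such an x exists, Max plays greedily with
   respect to x, and the finite part of x is a potential showing that Max earns
   at least lambda per turn.  Conversely, fix an optimal policy of Max.  The set
   D of states of maximal value is then closed under all actions of Min, and
   every policy of Min costs at least lambda per turn on D.  Consider the
   discounted problem on D in which Min may also stop at no cost.  The Poisson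
   equations of the finitely many policies bound its value below uniformly in
   the discount factor, and the value is nonincreasing in that factor; its limit
   at discount factor 1 is the required x on D, extended by -oo. *)
Require Import Defs.
From mathcomp Require Import all_boot all_order all_algebra.
From mathcomp Require Import all_classical all_reals all_analysis.
From mathcomp Require Import zify ring lra.

Set Implicit Arguments.
Unset Strict Implicit.
Unset Printing Implicit Defensive.

Import Order.TTheory GRing.Theory Num.Theory.
Import numFieldNormedType.Exports.

Local Open Scope ring_scope.

(** * Averages against probability distributions *)

Definition avg (R : realType) (n : nat) (p f : 'I_n -> R) : R :=
  \sum_l p l * f l.

Definition distribution (R : realType) (n : nat) (p : 'I_n -> R) : Prop :=
  (forall l, 0 <= p l) /\ \sum_l p l = 1.

Lemma avgZ (R : realType) n (p f : 'I_n -> R) c :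
  avg p (fun l => c * f l) = c * avg p f.
Proof. by rewrite /avg mulr_sumr; apply: eq_bigr => l _; rewrite mulrCA. Qed.

Lemma avgB (R : realType) n (p f g : 'I_n -> R) :
  avg p (fun l => f l - g l) = avg p f - avg p g.
Proof. by rewrite /avg -sumrB; apply: eq_bigr => l _; rewrite mulrBr. Qed.

Lemma avg_cst (R : realType) n (p : 'I_n -> R) c :
  distribution p -> avg p (fun=> c) = c.
Proof. by move=> [_ p1]; rewrite /avg -mulr_suml p1 mul1r. Qed.

Lemma le_avg (R : realType) n (p f g : 'I_n -> R) : distribution p ->
  (forall l, 0 < p l -> f l <= g l) -> avg p f <= avg p g.
Proof.
move=> [p0 _] fg; apply: ler_sum => l _.
have := p0 l; rewrite le_eqVlt => /predU1P[<-|pl]; first by rewrite !mul0r.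
by rewrite ler_pM2l // fg.
Qed.

(** Maximum principle: the nonnegative function [c - f] has nonpositive average, so it vanishes
    wherever [p] has mass. *)
Lemma avg_max_supp (R : realType) n (p f : 'I_n -> R) c : distribution p ->
  (forall l, f l <= c) -> c <= avg p f -> forall l, 0 < p l -> f l = c.
Proof.
move=> dp fc cf l pl.
have : avg p (fun l => c - f l) <= 0 by rewrite avgB avg_cst // subr_le0.
rewrite /avg (bigD1 l) //= => h; apply/eqP; rewrite eq_le fc /=.
rewrite -subr_le0 -(pmulr_rle0 _ pl); apply: le_trans h; rewrite lerDl.
by apply: sumr_ge0 => j _; rewrite mulr_ge0 ?subr_ge0 //; case: dp.
Qed.

Lemma norm_avg_le (R : realType) n (p f : 'I_n -> R) C : distribution p ->
  (forall l, `|f l| <= C) -> `|avg p f| <= C.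
Proof.
move=> dp fC; rewrite ler_norml; apply/andP; split.
  by rewrite -(avg_cst (- C) dp); apply: le_avg => // l _; have := fC l;
     rewrite ler_norml => /andP[].
by rewrite -(avg_cst C dp); apply: le_avg => // l _; have := fC l;
   rewrite ler_norml => /andP[].
Qed.

(** * Poisson equations of a stochastic matrix *)

Lemma le0_natmul_bounded (R : realType) (y C : R) :
  (forall N : nat, N%:R * y <= C) -> y <= 0.
Proof.
move=> h; rewrite leNgt; apply/negP => y0.
have := h (Num.truncn (C / y)).+1; apply/negP; rewrite -ltNge.
by rewrite -ltr_pdivrMr // truncnS_gt.
Qed.

(** Since [P] fixes [y], applying [P] to [z] [N] times gives [z - N * y]. Averaging does not
    increase the sup norm, so [N * y] is bounded in [N]. *)
Lemma stochastic_ker_im (R : realType) n (P : 'I_n -> 'I_n -> R)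
    (y z : 'I_n -> R) : (forall k, distribution (P k)) ->
  (forall k, avg (P k) y = y k) -> (forall k, y k = z k - avg (P k) z) ->
  forall k, y k = 0.
Proof.
move=> dP Py yz.
pose C := \sum_k `|z k|.
have zC k : `|z k| <= C by rewrite /C (bigD1 k) //= lerDl sumr_ge0.
have bnd (N : nat) k : `|z k - N%:R * y k| <= C.
  elim: N k => [|N IH] k; first by rewrite mul0r subr0.
  have -> : z k - N.+1%:R * y k = avg (P k) (fun l => z l - N%:R * y l).
    rewrite avgB avgZ Py -natr1; have := yz k; lra.
  exact: norm_avg_le.
move=> k; apply/eqP; rewrite eq_le; apply/andP; split.
  apply: (@le0_natmul_bounded _ _ (C + C)) => N.
  have := bnd N k; have := zC k; rewrite !ler_norml => /andP[? ?] /andP[? ?].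
  lra.
rewrite -oppr_le0; apply: (@le0_natmul_bounded _ _ (C + C)) => N.
have := bnd N k; have := zC k; rewrite !ler_norml => /andP[? ?] /andP[? ?].
rewrite mulrN; lra.
Qed.

(* A stochastic matrix has bounded powers, so [I - P] has no Jordan block at 0
   and the whole space is [ker (I - P) + im (I - P)]. *)
Lemma poisson_equation (R : realType) n (P : 'I_n -> 'I_n -> R)
    (r : 'I_n -> R) : (forall k, distribution (P k)) ->
  exists gv : ('I_n -> R) * ('I_n -> R),
    (forall k, avg (P k) gv.1 = gv.1 k) /\
    (forall k, r k + avg (P k) gv.2 = gv.1 k + gv.2 k).
Proof.
move=> dP.
(* [M] is the transpose of [P]: right multiplication of a row vector by [M] averages it as a
   function of the state. *)
pose M : 'M[R]_n := \matrix_(k, l) P l k.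
have mulM (u : 'rV[R]_n) k : (u *m M) 0 k = avg (P k) (fun l => u 0 l).
  by rewrite mxE; apply: eq_bigr => l _; rewrite mxE mulrC.
pose A := 1%:M - M.
have kerA (u : 'rV[R]_n) : (u <= kermx A)%MS ->
    forall k, avg (P k) (fun l => u 0 l) = u 0 k.
  move=> /sub_kermxP /eqP; rewrite mulmxBr mulmx1 subr_eq0 => /eqP uM k.
  by rewrite -mulM -uM.
have disj : (kermx A :&: A = 0)%MS.
  apply/eqP/rowV0P => u; rewrite sub_capmx => /andP[uk /submxP[z uz]].
  apply/rowP => k; rewrite mxE.
  apply: (stochastic_ker_im (y := fun l => u 0 l) (z := fun l => z 0 l) dP).
    exact: kerA.
  by move=> j; rewrite uz mulmxBr mulmx1 -mulM !mxE.
have full : row_full (kermx A + A)%MS.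
  by rewrite /row_full mxrank_disjoint_sum // mxrank_ker subnK // rank_leq_row.
have [[u v] /= e] := sub_addsmxP (submx_full (\row_k r k) full).
exists (fun k => (u *m kermx A) 0 k, fun k => v 0 k) => /=; split.
  by apply: kerA; apply: submxMl.
move=> k; move/rowP/(_ k): e; rewrite mulmxBr mulmx1 [LHS]mxE => ->.
by rewrite -mulM !mxE; ring.
Qed.

(** * The discounted problem with stopping *)

Section BoundedSubsolution.
Variables (R : realType) (n : nat) (A : finType).
Variables (act : 'I_n -> {set A}) (p : 'I_n -> A -> 'I_n -> R).
Variables (c : 'I_n -> A -> R) (D : {set 'I_n}) (lam : R).
Hypothesis p_distr : forall k a, a \in act k -> distribution (p k a).

(** The bound [x k <= 0] encodes the option of Min to stop at no cost. *)
Definition discounted_subsolution (al : R) (x : 'I_n -> R) : Prop :=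
  (forall k, x k <= 0) /\
  forall k a, k \in D -> a \in act k ->
    x k <= c k a - lam + al * avg (p k a) x.

Local Notation sub := discounted_subsolution.

(** Perron's method: the value is built as the largest subsolution. *)
Definition discounted_value (al : R) (k : 'I_n) : R :=
  sup [set y | exists2 x, sub al x & y = x k]%classic.

Local Notation V := discounted_value.

(** Bellman operator; the default 0 of the minimum is the option to stop. *)
Definition discounted_step (al : R) (x : 'I_n -> R) (k : 'I_n) : R :=
  if k \in D then
    \big[Num.min/0]_(a in act k) (c k a - lam + al * avg (p k a) x)
  else 0.

Section Discount.
Variable al : R.
Hypotheses (al0 : 0 <= al) (al1 : al < 1).

Lemma discounted_subsolution_exists : exists x, sub al x.
Proof.
pose K := \sum_k \sum_a `|c k a - lam|.
have K0 : 0 <= K by apply: sumr_ge0 => k _; apply: sumr_ge0.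
have d0 : 0 < 1 - al by rewrite subr_gt0.
(* This constant solves [t = - K + al * t]. *)
exists (fun=> - (K / (1 - al))); split => [k|k a _ ak].
  by rewrite oppr_le0 divr_ge0 // ltW.
rewrite avg_cst; last exact: p_distr.
have : `|c k a - lam| <= K.
  rewrite /K (bigD1 k) //= (bigD1 a) //= -addrA lerDl addr_ge0 ?sumr_ge0 //.
  by move=> j _; apply: sumr_ge0.
rewrite ler_norml => /andP[cK _].
rewrite -lerBlDr; apply: le_trans cK.
suff -> : - (K / (1 - al)) - al * - (K / (1 - al)) = - K by [].
by field; rewrite gt_eqF.
Qed.

Lemma discounted_value_ge x k : sub al x -> x k <= V al k.
Proof.
move=> sx; apply: ub_le_sup; last by exists x.
by exists 0 => _ [y [y0 _] ->].
Qed.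

Lemma discounted_value_le k M : (forall x, sub al x -> x k <= M) -> V al k <= M.
Proof.
move=> h; apply: ge_sup; last by move=> _ [x sx ->]; exact: h.
by have [x sx] := discounted_subsolution_exists; exists (x k); exists x.
Qed.

(** The right-hand sides are monotone in [x], as [0 <= al], so the constraints pass to the pointwise
    supremum. *)
Lemma discounted_value_sub : sub al (V al).
Proof.
split=> [k|k a kD ak]; first by apply: discounted_value_le => x [].
apply: discounted_value_le => x sx; apply: (le_trans (sx.2 k a kD ak)).
rewrite lerD2l ler_wpM2l // le_avg //; first exact: p_distr.
by move=> l _; exact: discounted_value_ge.
Qed.

(** A Bellman step only raises a subsolution, and raising [x] only relaxes the right-hand sides. *)
Lemma discounted_step_sub x : sub al x -> sub al (discounted_step al x).
Proof.
move=> [x0 sx]; split=> [k|k a kD ak].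
  rewrite /discounted_step; case: ifP => // _; exact: bigmin_le_id.
rewrite {1}/discounted_step kD.
apply: (le_trans (bigmin_le_cond _ _ ak)).
rewrite lerD2l ler_wpM2l // le_avg //; first exact: p_distr.
move=> l _; rewrite /discounted_step; case: ifP => // lD.
by apply: le_bigmin => // b bl; exact: sx.
Qed.

(* Bellman equation of the game in which the minimizer may stop at no cost. *)
Lemma discounted_value_greedy k :
  (k \in D) && (V al k < 0) -> exists2 a, a \in act k &
    c k a - lam + al * avg (p k a) (V al) <= V al k.
Proof.
case/andP=> kD Vk0.
have := discounted_value_ge k (discounted_step_sub discounted_value_sub).
rewrite {1}/discounted_step kD => /bigmin_leP[|//].
by rewrite leNgt Vk0.
Qed.

Lemma discounted_value_outside k : k \notin D -> V al k = 0.
Proof.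
move=> kD; apply/eqP; rewrite eq_le (discounted_value_sub.1 k) /=.
have := discounted_value_ge k (discounted_step_sub discounted_value_sub).
by rewrite /discounted_step (negbTE kD).
Qed.

End Discount.

Hypothesis act_neq0 : forall k, act k != finset.set0.
Hypothesis gain_ge : forall sigma g v, (forall k, sigma k \in act k) ->
  (forall k, avg (p k (sigma k)) g = g k) ->
  (forall k, c k (sigma k) + avg (p k (sigma k)) v = g k + v k) ->
  forall k, k \in D -> lam <= g k.

(** Let [(g, v)] solve the Poisson equations of a greedy policy and let [w] be the minimum of
    [V - v]. If Min continues at the minimizer, then [lam <= g] there gives
    [w >= al * w - (1 - al) * B], so [w >= - B]; otherwise [V] is 0 there and the bound on [v]
    suffices. *)
Lemma discounted_value_lbound : exists C, forall al, 0 <= al -> al < 1 ->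
  forall k, - C <= V al k.
Proof.
have /choice[gv gvP] (sigma : {ffun 'I_n -> A}) :
    exists gv : ('I_n -> R) * ('I_n -> R), (forall k, sigma k \in act k) ->
    (forall k, avg (p k (sigma k)) gv.1 = gv.1 k) /\
    (forall k, c k (sigma k) + avg (p k (sigma k)) gv.2 = gv.1 k + gv.2 k).
  have [s|ns] := pselect (forall k, sigma k \in act k); last first.
    by exists (fun=> 0, fun=> 0).
  have [|gv ?] := @poisson_equation R n (fun k => p k (sigma k))
    (fun k => c k (sigma k)); first by move=> k; exact: p_distr.
  by exists gv.
(* The greedy policy depends on [al]; summing over all policies makes [B] independent of it. *)
pose B := \sum_sigma \sum_k `|(gv sigma).2 k|.
have vB sigma k : `|(gv sigma).2 k| <= B.
  rewrite /B (bigD1 sigma) //= (bigD1 k) //= -addrA lerDl.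
  by rewrite addr_ge0 ?sumr_ge0 // => j _; apply: sumr_ge0.
exists (B + B) => al al0 al1.
(* Where Min stops, or outside [D], any available action will do. *)
have /choice[sig sigP] k : exists a, a \in act k /\
    ((k \in D) && (V al k < 0) ->
     c k a - lam + al * avg (p k a) (V al) <= V al k).
  have [kD|kD] := boolP ((k \in D) && (V al k < 0)); last first.
    by have /set0Pn[a ak] := act_neq0 k; exists a.
  by have [a ak ?] := discounted_value_greedy al0 al1 kD; exists a.
pose s := [ffun k => sig k].
have sact k : s k \in act k by rewrite ffunE; case: (sigP k).
have [Pg Pv] := gvP s sact.
set g := (gv s).1 in Pg Pv; set v := (gv s).2 in Pv.
have vBs k : `|v k| <= B := vB s k.
have g_ge k := gain_ge sact Pg Pv (k := k).
move=> k0; have d0 : 0 < 1 - al by rewrite subr_gt0.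
pose k := [arg min_(j < k0) (V al j - v j)]%O.
have kmin j : V al k - v k <= V al j - v j.
  by rewrite /k; case: arg_minP => // i _; exact.
suff : - B <= V al k - v k.
  have := kmin k0; have := vBs k0; rewrite ler_norml => /andP[? ?]; lra.
have := vBs k; rewrite ler_norml => /andP[v1 v2].
have Vk0 : V al k <= 0 by case: (discounted_value_sub al0 al1).
have [/[dup] /andP[kD Vk] kS|] := boolP ((k \in D) && (V al k < 0)); last first.
  rewrite negb_and -leNgt => /orP[/(discounted_value_outside al0 al1)|]; lra.
have := (sigP k).2 kS; have := Pv k; have := g_ge k kD; rewrite /s !ffunE.
set q := p k (sig k).
have dq : distribution q by apply: p_distr; case: (sigP k).
have := norm_avg_le dq vBs; rewrite ler_norml => /andP[_].
have : V al k - v k <= avg q (V al) - avg q v.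
  by rewrite -avgB -{1}(avg_cst (V al k - v k) dq); apply: le_avg.
rewrite -subr_ge0 => /(mulr_ge0 al0); rewrite -subr_ge0 => h1.
move=> h2 h3 h4 h5; rewrite -subr_ge0 -(pmulr_rge0 _ d0); nra.
Qed.

Lemma bounded_subsolution : exists x : 'I_n -> R, forall k a, k \in D ->
  a \in act k -> lam + x k <= c k a + avg (p k a) x.
Proof.
have [C VC] := discounted_value_lbound.
pose al (j : nat) : R := 1 - harmonic j.
have al0 j : 0 <= al j by rewrite subr_ge0 invf_le1 // ler1n.
have al1 j : al j < 1 by rewrite ltrBlDr ltrDl invr_gt0.
have al_mono i j : (i <= j)%N -> al i <= al j.
  by move=> ij; rewrite lerD2l lerN2 /harmonic /= lef_pV2 ?posrE // ler_nat.
(* Subsolutions are nonpositive, so lowering the discount factor raises the right-hand sides and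
   keeps them subsolutions. *)
have V_mono k : {homo (fun j => V (al j) k) : i j / (i <= j)%N >-> j <= i}.
  move=> i j ij; apply: discounted_value_ge.
  have [V0 Vs] := discounted_value_sub (al0 j) (al1 j).
  split=> // l a lD al_; apply: (le_trans (Vs l a lD al_)); rewrite lerD2l.
  apply: ler_wnM2r; last exact: al_mono.
  have dq := p_distr al_; rewrite -(avg_cst 0 dq); exact: le_avg.
have V_cvg k : cvgn (fun j => V (al j) k).
  apply: nonincreasing_is_cvgn => //; exists (- C) => _ [j _ <-]; exact: VC.
pose x k := limn (fun j => V (al j) k).
have V_lim k : (V (al j) k @[j --> \oo] --> x k)%classic by exact: V_cvg.
exists x => k a kD ak; rewrite -lerBrDl addrAC.
have al_cvg : (al j @[j --> \oo] --> (1 : R))%classic.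
  rewrite -[X in (_ --> X)%classic](subr0 1); apply: cvgB; first exact: cvg_cst.
  exact: cvg_harmonic.
rewrite -[avg _ _]mul1r.
apply: (@ler_cvg_to _ \oo%classic _ _ (fun j => V (al j) k)
  (fun j => c k a - lam + al j * avg (p k a) (V (al j)))).
- exact: V_lim.
- apply: cvgD; first exact: cvg_cst.
  apply: cvgM => //; rewrite /avg.
  apply: cvg_big => [|l _]; first exact: add_continuous.
  by apply: cvgM; [exact: cvg_cst|exact: V_lim].
- by near=> j; apply: (discounted_value_sub (al0 j) (al1 j)).2.
Unshelve. all: by end_near. Qed.

End BoundedSubsolution.

(** * Payoffs and the Markov chain of a pair of policies *)

Lemma sum_tuple_cons (R : realType) (T : finType) (N : nat)
    (F : N.+1.-tuple T -> R) :
  \sum_t F t = \sum_x \sum_(t : N.-tuple T) F [tuple of x :: t].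
Proof.
rewrite pair_big /=.
rewrite (reindex (fun xt : T * N.-tuple T => [tuple of xt.1 :: xt.2])) //=.
exists (fun t => (thead t, [tuple of behead t])) => [[x t] _|t _] /=.
  by rewrite theadE; congr (_, _); apply: val_inj.
by rewrite [RHS]tuple_eta.
Qed.

Section GameTransitions.
Variables (R : realType) (n m : nat) (G : smpg R n m).

Definition pawn_prob (a : {set 'I_m}) (i : 'I_m) : R :=
  if i \in a then #|a|%:R^-1 else 0.

(** A move of Min and the reply of Max are merged into one turn, which leaves a Markov chain on the
    states of Min alone. *)
Definition transition (tau : 'I_m -> 'I_n) (a : {set 'I_m}) (l : 'I_n) : R :=
  \sum_(i | tau i == l) pawn_prob a i.

Definition turn_payment (tau : 'I_m -> 'I_n) (k : 'I_n) (a : {set 'I_m}) : R :=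
  \sum_i pawn_prob a i * (min_pay G k a + max_pay G i (tau i)).

Lemma pawn_prob_ge0 a i : 0 <= pawn_prob a i.
Proof. by rewrite /pawn_prob; case: ifP. Qed.

Lemma pawn_prob_sum k a : a \in Defs.minA G k -> \sum_i pawn_prob a i = 1.
Proof.
move=> /minA_card ca; rewrite /pawn_prob -big_mkcond /= sumr_const.
by rewrite -[RHS](@divff _ (#|a|%:R : R)) ?mulr_natl //;
   case/orP: ca => /eqP ->; rewrite pnatr_eq0.
Qed.

Lemma avg_transition tau a f :
  avg (transition tau a) f = \sum_i pawn_prob a i * f (tau i).
Proof.
rewrite /avg [RHS](partition_big tau xpredT) //=.
apply: eq_bigr => l _; rewrite mulr_suml.
by apply: eq_bigr => i /eqP ->.
Qed.

Lemma transition_distribution tau k a :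
  a \in Defs.minA G k -> distribution (transition tau a).
Proof.
move=> ka; split=> [l|]; first by apply: sumr_ge0 => i _; exact: pawn_prob_ge0.
by rewrite -(pawn_prob_sum ka) [RHS](partition_big tau xpredT).
Qed.

Lemma transition_gt0 tau k a i : a \in Defs.minA G k -> i \in a ->
  0 < transition tau a (tau i).
Proof.
move=> /minA_card ca ia; rewrite /transition (bigD1 i) //=.
apply: ltr_wpDr; first by apply: sumr_ge0 => j _; exact: pawn_prob_ge0.
by rewrite /pawn_prob ia invr_gt0 ltr0n; case/orP: ca => /eqP ->.
Qed.

Lemma transition_supp tau a l :
  0 < transition tau a l -> exists2 i, i \in a & tau i = l.
Proof.
move=> h; apply: contrapT => nex; move: h; rewrite /transition big1 ?ltxx //.
move=> i /eqP il; rewrite /pawn_prob; case: ifP => // ia.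
by case: nex; exists i.
Qed.

Lemma traj_prob_sum sigma tau k N : min_policy G sigma ->
  \sum_(s : N.-tuple 'I_m) traj_prob R sigma tau k s = 1.
Proof.
move=> ms; elim: N k => [|N IH] k.
  rewrite (eq_bigr (fun=> 1)) => [|t _]; last by rewrite (tuple0 t).
  by rewrite sumr_const card_tuple expn0.
rewrite sum_tuple_cons -(pawn_prob_sum (ms k)); apply: eq_bigr => i _ /=.
by rewrite -mulr_sumr IH mulr1.
Qed.

Definition total_payment (sigma : 'I_n -> {set 'I_m}) (tau : 'I_m -> 'I_n)
    (k : 'I_n) (N : nat) : R :=
  \sum_(s : N.-tuple 'I_m) traj_prob R sigma tau k s * traj_payment G sigma tau k s.

Lemma total_paymentS sigma tau k N : min_policy G sigma ->
  total_payment sigma tau k N.+1 = turn_payment tau k (sigma k) +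
    avg (transition tau (sigma k)) (fun l => total_payment sigma tau l N).
Proof.
move=> ms; rewrite /total_payment sum_tuple_cons avg_transition -big_split /=.
apply: eq_bigr => i _; rewrite -mulrDr; set w := min_pay _ _ _ + _.
rewrite [X in _ = _ * (X + _)](_ : w =
    \sum_(s : N.-tuple 'I_m) traj_prob R sigma tau (tau i) s * w); last first.
  by rewrite -mulr_suml traj_prob_sum // mul1r.
rewrite -big_split mulr_sumr; apply: eq_bigr => s _ /=.
by rewrite -/(pawn_prob _ _) -/w; ring.
Qed.

(** The total payment over [N] turns is [N * g + v + U N], where [U N] is the [N]-fold average of
    [- v] and hence bounded. Dividing by [2 * N] leaves [g / 2] in the limit. *)
Lemma payoff_poisson sigma tau g v : min_policy G sigma ->
  (forall k, avg (transition tau (sigma k)) g = g k) ->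
  (forall k, turn_payment tau k (sigma k) +
     avg (transition tau (sigma k)) v = g k + v k) ->
  forall k, payoff G sigma tau k = 2^-1 * g k.
Proof.
move=> ms Pg Pv k.
have dP j := transition_distribution tau (ms j).
pose C := \sum_j `|v j|.
have vC j : `|v j| <= C by rewrite /C (bigD1 j) //= lerDl sumr_ge0.
pose U N j := total_payment sigma tau j N - N%:R * g j - v j.
have UC N j : `|U N j| <= C.
  elim: N j => [|N IH] j.
    rewrite /U mul0r subr0 /total_payment big1 ?sub0r ?normrN //.
    by move=> t _; rewrite (tuple0 t) /= mulr0.
  have -> : U N.+1 j = avg (transition tau (sigma j)) (U N).
    rewrite /U total_paymentS // !avgB avgZ Pg -natr1; have := Pv j; lra.
  exact: norm_avg_le.
have meanE N : mean_payment G sigma tau k N.+1 =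
    2^-1 * g k + (2^-1 * harmonic N) * (v k + U N.+1 k).
  have -> : mean_payment G sigma tau k N.+1 =
      (2 * N.+1%:R)^-1 * total_payment sigma tau k N.+1.
    rewrite /mean_payment /total_payment mulr_sumr; apply: eq_bigr => s _.
    by rewrite mulrCA.
  have -> : total_payment sigma tau k N.+1 = v k + U N.+1 k + N.+1%:R * g k.
    by rewrite /U; ring.
  by rewrite /harmonic /=; field; rewrite ?pnatr_eq0.
(* The shift skips [N = 0], where the factor [(2 * N)^-1] is degenerate. *)
apply: cvg_lim => //; rewrite -cvg_shiftS /=.
under eq_fun do rewrite meanE.
suff h : (2^-1 * harmonic N * (v k + U N.+1 k) @[N --> \oo] --> (0 : R))%classic.
  by have := cvgD (cvg_cst (2^-1 * g k)) h; rewrite addr0; exact.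
apply/cvgr0Pnorm_le => e e0.
have /cvgr0Pnorm_le h := @cvg_harmonic R.
have C0 : 0 <= C by apply: sumr_ge0.
(* The [+ 1] keeps the denominator positive when [C = 0]. *)
have eC : 0 < e / (C + 1) by rewrite divr_gt0 //; lra.
near=> N.
have hN : `|harmonic N| <= e / (C + 1) by near: N; exact: h.
rewrite !normrM.
have := ler_normD (v k) (U N.+1 k); have := vC k; have := UC N.+1 k.
move=> h1 h2 h3.
have h4 : `|harmonic N| * (C + 1) <= e by rewrite -ler_pdivlMr //; lra.
have h5 : `|v k + U N.+1 k| <= 2 * (C + 1) by lra.
have -> : `|2^-1 : R| = 2^-1 by rewrite ger0_norm.
have := ler_wpM2l (normr_ge0 (harmonic N)) h5; lra.
Unshelve. all: by end_near. Qed.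

Lemma policy_poisson sigma tau : min_policy G sigma ->
  exists g v, [/\ forall k, avg (transition tau (sigma k)) g = g k,
    forall k, turn_payment tau k (sigma k) +
      avg (transition tau (sigma k)) v = g k + v k &
    forall k, payoff G sigma tau k = 2^-1 * g k].
Proof.
move=> ms.
have [|[g v] [Pg Pv]] := @poisson_equation R n
  (fun k => transition tau (sigma k)) (fun k => turn_payment tau k (sigma k)).
  by move=> k; exact: transition_distribution (ms k).
by exists g, v; split=> //; exact: payoff_poisson Pv.
Qed.

(* On a set [D] that Min cannot leave against [tau], [y] is a potential
   certifying that Max earns at least [lam] per turn. *)
Definition max_certificate (lam : R) (D : {set 'I_n}) (tau : 'I_m -> 'I_n)
    (y : 'I_n -> R) : Prop :=
  forall k a, k \in D -> a \in Defs.minA G k ->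
    (forall i, i \in a -> tau i \in D) /\
    lam + y k <= turn_payment tau k a + avg (transition tau a) y.

(** * Certificates and the value of the game *)

Variable chi : 'I_n -> R.
Hypothesis chi_value : is_value G chi.

(** Let [(g, v)] solve the Poisson equations of [tau] against an optimal policy of Min. At a
    maximizer of [y - v] on [D], subtracting them from the certificate leaves [lam <= g], and [g] is
    twice the payoff. *)
Lemma certificate_le_value lam D tau y : D != finset.set0 -> max_policy G tau ->
  max_certificate lam D tau y -> exists k, lam <= 2 * chi k.
Proof.
move=> /set0Pn[k0 k0D] mt cert; have [s0 [t0 [ms _ opt]]] := chi_value.
have [g [v [_ Pv pay]]] := policy_poisson tau ms.
pose k := [arg max_(j > k0 in D) (y j - v j)]%O.
have [kD kmax] : k \in D /\ forall j, j \in D -> y j - v j <= y k - v k.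
  by rewrite /k; case: arg_maxP => // i iD h; split=> // j jD; exact: h.
exists k; have [le_chi _] := opt k s0 tau ms mt.
have [aD cy] := cert k _ kD (ms k).
have dq := transition_distribution tau (ms k).
have : avg (transition tau (s0 k)) (fun l => y l - v l) <= y k - v k.
  rewrite -[leRHS](avg_cst _ dq); apply: le_avg => // l /transition_supp[i ia <-].
  by apply/kmax/aD.
rewrite avgB; have := Pv k; rewrite pay in le_chi; lra.
Qed.

(* Otherwise let Min always play [a] in [k].  The gain difference [d >= 0] of the
   two policies is subharmonic, strictly at [k], so its argmax is closed and
   avoids [k]; there the policies agree and the Poisson equations give d <= 0. *)
Lemma value_le_avg s0 t0 k a : min_policy G s0 ->
  (forall l sigma, min_policy G sigma ->
     payoff G s0 t0 l <= payoff G sigma t0 l) -> a \in Defs.minA G k ->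
  payoff G s0 t0 k <= avg (transition t0 a) (payoff G s0 t0).
Proof.
move=> ms opt ka; rewrite leNgt; apply/negP => lt_k.
pose s1 j := if j == k then a else s0 j.
have ms1 : min_policy G s1 by move=> j; rewrite /s1; case: eqP => [->|].
have [g0 [v0 [Pg0 Pv0 pay0]]] := policy_poisson t0 ms.
have [g1 [v1 [Pg1 Pv1 pay1]]] := policy_poisson t0 ms1.
have dP j := transition_distribution t0 (ms1 j).
have lt0 : avg (transition t0 a) g0 < g0 k.
  move: lt_k; rewrite pay0 (_ : payoff G s0 t0 = fun l => 2^-1 * g0 l).
    by rewrite avgZ; lra.
  exact/funext.
pose d j := g1 j - g0 j.
have d0 j : 0 <= d j.
  by have := opt j s1 ms1; rewrite pay0 pay1 /d; lra.
have Pd j : d j <= avg (transition t0 (s1 j)) d ?= iff (j != k).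
  rewrite /d avgB Pg1; apply/leifP; case: eqP => [->|/eqP jk] /=.
    by rewrite /s1 eqxx; lra.
  by rewrite /s1 (negbTE jk) Pg0.
pose j0 := [arg max_(j > k) d j]%O.
have dmax j : d j <= d j0 by rewrite /j0; case: arg_maxP => // i _; exact.
have succ j l : d j = d j0 -> 0 < transition t0 (s1 j) l -> d l = d j0.
  move=> dj; apply: (avg_max_supp (dP j) dmax); rewrite -dj.
  by case: (Pd j).
have d_avg j : avg (transition t0 (s1 j)) d <= d j0.
  by rewrite -[leRHS](avg_cst _ (dP j)); apply: le_avg.
have dk : d k < d j0.
  apply: lt_le_trans (d_avg k); rewrite lt_neqAle (Pd k).1.
  by rewrite (Pd k).2 eqxx.
(* A maximizer of the bias difference within the argmax of [d]: subtracting the two Poisson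
   equations there gives [d j1 <= 0], against [0 <= d k < d j1]. *)
pose j1 := [arg max_(j > j0 | d j == d j0) (v1 j - v0 j)]%O.
have [dj1 j1max] : d j1 = d j0 /\
    forall j, d j = d j0 -> v1 j - v0 j <= v1 j1 - v0 j1.
  rewrite /j1; case: arg_maxP => // i /eqP di h; split=> // j dj.
  by apply: h; rewrite dj.
have j1k : j1 != k by apply: contraTneq dk => <-; rewrite dj1 ltxx.
have s1j : s1 j1 = s0 j1 by rewrite /s1 (negbTE j1k).
have : avg (transition t0 (s1 j1)) (fun l => v1 l - v0 l) <= v1 j1 - v0 j1.
  rewrite -[leRHS](avg_cst _ (dP j1)); apply: le_avg => // l pl.
  by apply: j1max; apply: succ pl.
rewrite avgB; have := Pv1 j1; have := Pv0 j1; rewrite s1j.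
by have := d0 k; rewrite /d in dj1 dk *; lra.
Qed.

Lemma value_le_certificate lam k : lam <= 2 * chi k ->
  exists D tau y, [/\ D != finset.set0, max_policy G tau &
    max_certificate lam D tau y].
Proof.
move=> lam_le; have [s0 [t0 [ms mt opt]]] := chi_value.
have chiE : payoff G s0 t0 = chi.
  apply/funext => j; apply/eqP; rewrite eq_le.
  by have [-> ->] := opt j s0 t0 ms mt.
have opt0 j sigma : min_policy G sigma -> chi j <= payoff G sigma t0 j.
  by move=> msg; case: (opt j sigma t0 msg mt).
pose k0 := [arg max_(j > k) chi j]%O.
have chi_max j : chi j <= chi k0 by rewrite /k0; case: arg_maxP => // i _; exact.
pose D := finset (fun j => chi j == chi k0).
have [||x xP] := @bounded_subsolution R n _ (Defs.minA G)
    (fun _ a => transition t0 a) (turn_payment t0) D lam _ (minA_neq0 G).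
- by move=> j a; exact: transition_distribution.
- move=> sigma g v msg Pg Pv j; rewrite inE => /eqP chij.
  have := opt0 j sigma msg; rewrite (payoff_poisson msg Pg Pv) chij.
  by have := chi_max k; lra.
exists D, t0, x; split=> //; first by apply/set0Pn; exists k0; rewrite inE.
move=> j a jD ja; split; last exact: xP.
move=> i ia; rewrite inE; apply/eqP; move: jD; rewrite inE => /eqP chij.
(* No action of Min lowers [chi] on average, so from a state of maximal value the maximum principle
   puts every successor in [D]. *)
apply: (avg_max_supp (transition_distribution t0 ja) chi_max _).
  rewrite -chij -chiE; apply: value_le_avg => // l sigma msg.
  by rewrite chiE; exact: opt0.
exact: transition_gt0 ja ia.
Qed.

End GameTransitions.

(** * Tropical maxima and payments of the associated game *)

Lemma bigmaxe_attained (R : realType) (I : finType) (P : pred I)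
    (F : I -> \bar R) :
  let M := \big[maxe/-oo%E]_(i | P i) F i in
  M = -oo%E \/ exists2 i, P i & M = F i.
Proof.
move=> /=; apply: (big_ind (fun M => M = -oo%E \/ exists2 i, P i & M = F i)) => [|x y hx hy|i Pi]; first by left.
  by rewrite /maxe; case: ifP.
by right; exists i.
Qed.

Lemma term_le_Qplus (R : realType) n m (Q : 'I_n -> 'M[strop R]_m) (i j : 'I_m) x k :
  tpos (Q k i j) -> (tmod (Q k i j) + x k <= Qplus Q i j x)%E.
Proof. by move=> pk; rewrite /Qplus; apply: (bigmax_sup k). Qed.

Lemma term_le_Qminus (R : realType) n m (Q : 'I_n -> 'M[strop R]_m) (i j : 'I_m) x k :
  tneg (Q k i j) -> (tmod (Q k i j) + x k <= Qminus Q i j x)%E.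
Proof. by move=> nk; rewrite /Qminus; apply: (bigmax_sup k). Qed.

(* For i = j this is the singleton action {i}, hence no case distinction. *)
Lemma pawn_prob_set2 (R : realType) m (i j : 'I_m) (f : 'I_m -> R) :
  \sum_l pawn_prob R [set i; j]%SET l * f l = 2^-1 * (f i + f j).
Proof.
have E l : pawn_prob R [set i; j]%SET l * f l =
    if l \in [set i; j]%SET then #|[set i; j]%SET|%:R^-1 * f l else 0.
  by rewrite /pawn_prob; case: ifP => // _; rewrite mul0r.
rewrite (eq_bigr _ (fun l _ => E l)) -big_mkcond /= cards2.
have [<-|ij] := eqVneq i j; first by rewrite finset.setUid big_set1 /=; field.
by rewrite big_setU1 ?inE //= big_set1 mulrDr.
Qed.

Lemma assoc_min_payE (R : realType) n m (Q : 'I_n -> 'M[strop R]_m) k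
    (i j : 'I_m) : (i <= j)%N ->
  assoc_min_pay Q k [set i; j]%SET = - fine (tmod (Q k i j)).
Proof.
move=> ij; rewrite /assoc_min_pay; case: pickP => [[i' j'] /=|/(_ (i, j))].
  case/andP=> ij' /eqP /setP e.
  have := e i; have := e j; have := e i'; have := e j'.
  rewrite !inE !eqxx /= !orbT /= -!(inj_eq val_inj) /= => e1 e2 e3 e4.
  suff [-> ->] : i' = i /\ j' = j by [].
  by split; apply: val_inj => /=; lia.
by rewrite /= ij eqxx.
Qed.

(** * Certificates as points of the spectrahedron *)

Section Translation.
Variables (R : realType) (n m : nat) (Q : 'I_n -> 'M[strop R]_m).
Hypotheses (Qsym : forall k, tsymmetric (Q k))
  (Qneg : forall k, exists i j, tneg (Q k i j))
  (Qpos : forall i, exists k, tpos (Q k i i)).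

Local Notation G := (assoc_game Qsym Qneg Qpos).

Lemma assoc_minAP k a :
  reflect (exists i j : 'I_m, [/\ (i <= j)%N, tneg (Q k i j) &
    a = [set i; j]%SET]) (a \in Defs.minA G k).
Proof.
rewrite inE; apply: (iffP existsP) => [[i /existsP[j /and3P[? ? /eqP]]]|].
  by exists i, j.
by case=> i [j [ij nij ->]]; exists i; apply/existsP; exists j; apply/and3P.
Qed.

(** Doubled, the certificate inequality for [{i, j}] thus becomes the constraint of [tspec] at
    [(i, j)], with [tau] selecting the terms of [Qplus]; [i = j] gives twice the diagonal
    constraint. *)
Lemma assoc_turn (tau : 'I_m -> 'I_n) k (i j : 'I_m) (y : 'I_n -> R) :
  (i <= j)%N ->
  turn_payment G tau k [set i; j]%SET +
    avg (transition R tau [set i; j]%SET) y =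
  2^-1 * ((fine (tmod (Q (tau i) i i)) + y (tau i)) +
          (fine (tmod (Q (tau j) j j)) + y (tau j))) - fine (tmod (Q k i j)).
Proof.
move=> ij; rewrite avg_transition /turn_payment !pawn_prob_set2 /=.
by rewrite assoc_min_payE // /assoc_max_pay; field.
Qed.

Lemma tspec_certificate lam : nontrivial (tspec Q lam) ->
  exists D tau y, [/\ D != finset.set0, max_policy G tau &
    max_certificate G lam D tau y].
Proof.
case=> x [xoo xdiag xoff] xn.
(* Greedy policy of Max; if [Qplus] is [-oo], every available move attains it. *)
have /choice[tau tauP] i : exists k, tpos (Q k i i) /\
    Qplus Q i i x = (tmod (Q k i i) + x k)%E.
  case: (bigmaxe_attained (fun k => tpos (Q k i i))
    (fun k => tmod (Q k i i) + x k)%E) => [e|[k pk e]]; last by exists k.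
  have [k pk] := Qpos i; exists k; split=> //.
  rewrite /Qplus e; apply/esym/eqP; rewrite -leeNy_eq -e.
  exact: term_le_Qplus.
pose D := finset (fun k => x k != -oo%E).
pose y k := fine (x k).
have xE k : k \in D -> x k = (y k)%:E.
  rewrite inE => xk; rewrite /y fineK // fin_numE xk /=.
  by rewrite -ltey xoo.
exists D, tau, y; split.
- apply/negP => /eqP D0; apply: xn; apply/funext => k.
  have : k \notin D by rewrite D0 inE.
  by rewrite inE negbK => /eqP.
- by move=> i; rewrite inE; case: (tauP i).
move=> k a kD /assoc_minAP[i [j [ij nij ->]]].
have modE : tmod (Q k i j) = (fine (tmod (Q k i j)))%:E by case: (Q k i j) nij.
set q := fine (tmod (Q k i j)) in modE.
have le_minus : ((q + y k)%:E <= Qminus Q i j x)%E.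
  rewrite EFinD -modE -xE //.
  exact: term_le_Qminus.
(* Common form of both families of constraints: the diagonal one is added to itself. *)
have key : ((2 * (lam + (q + y k)))%:E <= Qplus Q i i x + Qplus Q j j x)%E.
  have [eij|ne_ij] := eqVneq i j.
    have := xdiag i; rewrite -{}eij in le_minus *.
    move=> /(le_trans (leeD2l lam%:E le_minus)) h.
    by apply: le_trans (leeD h h); rewrite -!EFinD lee_fin mulr2n mulrDl mul1r.
  have ltij : (i < j)%N by rewrite ltn_neqAle ij andbT.
  apply: le_trans (xoff i j ltij).
  rewrite EFinM lee_pmul2l // EFinD; exact: leeD2l.
have tau_fin l : Qplus Q l l x != -oo%E -> tau l \in D /\
    Qplus Q l l x = (fine (tmod (Q (tau l) l l)) + y (tau l))%:E.
  have [pl ->] := tauP l.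
  have -> : tmod (Q (tau l) l l) = (fine (tmod (Q (tau l) l l)))%:E.
    by case: (Q (tau l) l l) pl.
  move=> h; have tD : tau l \in D by rewrite inE; apply: contraNneq h => ->.
  by split=> //; rewrite xE.
(* The left side of [key] is finite, so neither summand on the right is [-oo]; hence the greedy
   replies stay in [D]. *)
have Qi : Qplus Q i i x != -oo%E.
  by apply: contraTneq key => ->; rewrite addNye leNgt ltNyr.
have Qj : Qplus Q j j x != -oo%E.
  by apply: contraTneq key => ->; rewrite addeNy leNgt ltNyr.
have [iD Ei] := tau_fin i Qi; have [jD Ej] := tau_fin j Qj.
split; first by move=> l; rewrite in_set2 => /orP[] /eqP ->.
by rewrite assoc_turn // -/q; move: key; rewrite Ei Ej -EFinD lee_fin; lra.
Qed.

Lemma certificate_tspec lam D tau y : D != finset.set0 -> max_policy G tau ->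
  max_certificate G lam D tau y -> nontrivial (tspec Q lam).
Proof.
move=> /set0Pn[k0 k0D] mt cert.
pose x k : \bar R := if k \in D then (y k)%:E else -oo%E.
pose A i := fine (tmod (Q (tau i) i i)) + y (tau i).
have A_le i : tau i \in D -> ((A i)%:E <= Qplus Q i i x)%E.
  move=> tD; have : tau i \in Defs.maxB G i by exact: mt.
  rewrite inE => pt; apply: le_trans (term_le_Qplus x pt).
  by rewrite /A /x tD; case: (Q (tau i) i i) pt.
(* Either the maximum is attained at a state of [D], whose certificate for [{i, j}] yields the
   constraint, or it is [-oo] and the constraint is void. *)
have Qminus_fin (i j : 'I_m) : (i <= j)%N -> Qminus Q i j x = -oo%E \/
    exists z, [/\ (lam%:E + Qminus Q i j x)%E = z%:E, 2 * z <= A i + A j,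
      ((A i)%:E <= Qplus Q i i x)%E & ((A j)%:E <= Qplus Q j j x)%E].
  move=> ij; case: (bigmaxe_attained (fun k => tneg (Q k i j))
    (fun k => tmod (Q k i j) + x k)%E) => [e|[k nk e]]; first by left.
  have [kD|kD] := boolP (k \in D); last first.
    by left; rewrite /Qminus e /x (negbTE kD) addeNy.
  right; exists (lam + (fine (tmod (Q k i j)) + y k)).
  have [|tD] := cert k [set i; j]%SET kD.
    by apply/assoc_minAP; exists i, j.
  rewrite assoc_turn // -/(A i) -/(A j) => le_y; split.
  - by rewrite /Qminus e /x kD; case: (Q k i j) nk.
  - lra.
  - by apply/A_le/tD; rewrite !inE eqxx.
  - by apply/A_le/tD; rewrite !inE eqxx orbT.
exists x; last by move=> /(congr1 (fun f => f k0)); rewrite /x k0D.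
split=> [k|i|i j ij].
- by rewrite /x; case: ifP => _; rewrite ?ltry ?ltNyr.
- have [->|[z [-> zA Ai _]]] := Qminus_fin i i (leqnn i).
    by rewrite addeNy leNye.
  by apply: le_trans Ai; rewrite lee_fin; lra.
- have [->|[z [-> zA Ai Aj]]] := Qminus_fin i j (ltnW ij).
    by rewrite addeNy mulrNy gtr0_sg // mul1e leNye.
  by apply: le_trans (leeD Ai Aj); rewrite -EFinM -EFinD lee_fin.
Qed.

End Translation.

(** A maximum over a nonempty index set is attained; for [n = 0] it is [-oo] and both sides fail. *)
Lemma le_double_bigmax (R : realType) n (chi : 'I_n -> R) lam :
  (lam%:E <= 2%:E * \big[maxe/-oo]_(k < n) (chi k)%:E)%E <->
  exists k, lam <= 2 * chi k.
Proof.
split=> [|[k lk]].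
  case: (bigmaxe_attained xpredT (fun k => (chi k)%:E)) => [->|[k _ ->]].
    by rewrite mulrNy gtr0_sg // mul1e leNgt ltNyr.
  by rewrite -EFinM lee_fin; exists k.
apply: (@le_trans _ _ (2%:E * (chi k)%:E)%E); first by rewrite -EFinM lee_fin.
by rewrite lee_pmul2l //; apply: (bigmax_sup k).
Qed.

Theorem theorem23 (R : realType) (n m : nat) (Q : 'I_n -> 'M[strop R]_m)
    (Qsym : forall k, tsymmetric (Q k))
    (Qmetzler : forall k, tropical_Metzler (Q k))
    (Qneg : forall k, exists i j, tneg (Q k i j))
    (Qpos : forall i, exists k, tpos (Q k i i))
    (chi : 'I_n -> R)
    (chi_value : is_value (assoc_game Qsym Qneg Qpos) chi) :
  (forall lambda : R,
     nontrivial (tspec Q lambda) <->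
     (lambda%:E <= 2%:E * \big[maxe/-oo]_(k < n) (chi k)%:E)%E) /\
  (nontrivial (tspec Q 0) <-> exists k : 'I_n, winning chi k).
Proof.
have main lam : nontrivial (tspec Q lam) <-> exists k, lam <= 2 * chi k.
  split=> [/(tspec_certificate Qsym Qneg Qpos)[D [tau [y []]]]|[k]].
    exact: certificate_le_value.
  move/(value_le_certificate chi_value) => [D [tau [y []]]].
  exact: certificate_tspec.
split=> [lam|]; first by rewrite main le_double_bigmax.
by rewrite main; split=> -[k h]; exists k; move: h; rewrite /winning pmulr_rge0.
Qed.
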